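(* Let $\mathbb{F}_q$ be a finite field and $\lambda=(1,1)$. For the action of the Radon transform $\mathcal{R}$ on $\mathbb{C}[GL_2(\mathbb{F}_q)/U_\lambda]$, the eigenvalue $q^2$ occurs with multiplicity $q-1$, the eigenvalue $q$ occurs with multiplicity $(q-1)(q^2-q-2)$, and the eigenvalue $1$ occurs with multiplicity $(q-1)q$.
   Context: $U_{(1,1)}\subset GL_2(\mathbb{F}_q)$ is the group of upper triangular matrices with $1$'s on the diagonal and $U_{(1,1)}^{op}$ is the group of lower triangular matrices with $1$'s on the diagonal. For a subgroup $H$ of a finite group $G$, $e_H=\frac{1}{|H|}\sum_{h\in H}h\in\mathbb{C}[G]$ and $\mathbb{C}[G/H]=\mathbb{C}[G]e_H$ is the space of right $H$-invariant elements of $\mathbb{C}[G]$. The Radon transform is the operator on $\mathbb{C}[GL_2(\mathbb{F}_q)/U_\lambda]$ of right multiplication by $\mathcal{R}=|U_\lambda|^2e_{U_\lambda}e_{U_\lambda^{op}}e_{U_\lambda}$. (Multiplicity $0$ means that the number is not an eigenvalue.) *)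

(* Defs.v *)
From HB Require Import structures.
From mathcomp Require Import all_boot all_order all_algebra all_fingroup.
From mathcomp Require Import all_field.
From mathcomp Require Import reals complex.

Set Implicit Arguments.
Unset Strict Implicit.
Unset Printing Implicit Defensive.

Import GRing.Theory.

Local Open Scope ring_scope.

Set Warnings "-redundant-canonical-projection".

(* K[G] as an algebra over the field K: the function a : G -> K stands for the
   formal sum \sum_g a(g) g.  The type is an alias of a finfun type, because the
   latter already carries the pointwise product. *)
Definition group_algebra (K : fieldType) (gT : finGroupType) : Type :=
  {ffun gT -> K^o}.

Section GroupAlgebra.

Variables (K : fieldType) (gT : finGroupType).

Local Notation A := (group_algebra K gT).

HB.instance Definition _ := Vector.copy A {ffun gT -> K^o}.

Definition ga_basis (g : gT) : A := [ffun x => (x == g)%:R].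

Definition ga_mul (a b : A) : A :=
  [ffun g : gT => \sum_(h : gT) (a h : K) * (b (h^-1 * g)%g : K)].

Fact ga_mulA : associative ga_mul.
Proof.
move=> a b c; apply/ffunP => g; rewrite !ffunE.
under eq_bigr => h _ do rewrite ffunE mulr_sumr.
under [RHS]eq_bigr => h _ do rewrite ffunE mulr_suml.
rewrite [RHS]exchange_big; apply: eq_bigr => h _.
rewrite [RHS](reindex_inj (mulgI h)); apply: eq_bigr => k _ /=.
by rewrite mulrA mulKg invMg mulgA.
Qed.

Fact ga_mul1 : left_id (ga_basis 1%g) ga_mul.
Proof.
move=> a; apply/ffunP => g; rewrite ffunE (bigD1 1%g) //= big1 => [|h nh1].
  by rewrite ffunE eqxx mul1r invg1 mul1g addr0.
by rewrite ffunE (negbTE nh1) mul0r.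
Qed.

Fact ga_mulr1 : right_id (ga_basis 1%g) ga_mul.
Proof.
move=> a; apply/ffunP => g; rewrite ffunE (bigD1 g) //= big1 => [|h nhg].
  by rewrite ffunE mulVg eqxx mulr1 addr0.
by rewrite ffunE -eq_mulVg1 (negbTE nhg) mulr0.
Qed.

Fact ga_mulDl : left_distributive ga_mul +%R.
Proof.
move=> a b c; apply/ffunP => g; rewrite !ffunE -big_split.
by apply: eq_bigr => h _; rewrite ffunE mulrDl.
Qed.

Fact ga_mulDr : right_distributive ga_mul +%R.
Proof.
move=> a b c; apply/ffunP => g; rewrite !ffunE -big_split.
by apply: eq_bigr => h _; rewrite ffunE mulrDr.
Qed.

Fact ga_one_neq0 : ga_basis 1%g != 0 :> A.
Proof.
apply/eqP => /ffunP/(_ 1%g)/eqP.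
by rewrite !ffunE eqxx (oner_eq0 K).
Qed.

HB.instance Definition _ := GRing.Zmodule_isNzRing.Build A
  ga_mulA ga_mul1 ga_mulr1 ga_mulDl ga_mulDr ga_one_neq0.

Fact ga_scaleAl (k : K) (a b : A) : k *: (a * b) = k *: a * b.
Proof.
apply/ffunP => g; rewrite !ffunE scaler_sumr.
by apply: eq_bigr => h _; rewrite ffunE -mulrA.
Qed.

HB.instance Definition _ := GRing.Lmodule_isLalgebra.Build K A ga_scaleAl.

Fact ga_scaleAr (k : K) (a b : A) : k *: (a * b) = a * (k *: b).
Proof.
apply/ffunP => g; rewrite !ffunE scaler_sumr.
by apply: eq_bigr => h _; rewrite ffunE; apply: mulrCA.
Qed.

HB.instance Definition _ := GRing.Lalgebra_isAlgebra.Build K A ga_scaleAr.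
HB.instance Definition _ := Algebra_isFalgebra.Build K A.

Definition subgroup_idem (H : {group gT}) : A :=
  #|H|%:R^-1 *: \sum_(h in H) ga_basis h.

(* K[G/H] = K[G] e_H *)
Definition coset_space (H : {group gT}) : {vspace A} :=
  limg (amulr (subgroup_idem H)).

Fact ga_mul_basis (a : A) (h g : gT) :
  (a * ga_basis h) g = a (g * h^-1)%g.
Proof.
rewrite ffunE (bigD1 (g * h^-1)%g) //= big1 => [|k nk].
  by rewrite ffunE invMg invgK mulgKV eqxx mulr1 addr0.
rewrite ffunE (_ : (_ == h) = false) ?mulr0 //.
by apply/negbTE; apply: contraNneq nk => <-; rewrite invMg invgK mulKVg.
Qed.

Fact mem_coset_space (H : {group gT}) (a : A) : #|H|%:R != 0 :> K ->
  reflect {in H, forall h g, a (g * h)%g = a g} (a \in coset_space H).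
Proof.
move=> H0.
have mulE (b : A) g :
    (b * subgroup_idem H) g = #|H|%:R^-1 * \sum_(h in H) b (g * h^-1)%g.
  rewrite -scalerAr mulr_sumr ffunE sum_ffunE; congr (_ * _).
  by apply: eq_bigr => h _; rewrite ga_mul_basis.
apply: (iffP memv_imgP) => [[b _ ->] h Hh g | aH].
  rewrite lfunE /= !mulE; congr (_ * _).
  rewrite (reindex_inj (mulIg h)) /=; apply: eq_big => [k | k _].
    by rewrite groupMr.
  by rewrite invMg mulgA mulgK.
exists a; first exact: memvf.
apply/ffunP => g; rewrite lfunE /= mulE.
rewrite (eq_bigr (fun=> a g)) => [|h Hh]; last by rewrite aH ?groupV.
by rewrite sumr_const -[X in _ * X]mulr_natl mulKf.
Qed.

End GroupAlgebra.

(* Multiplicity of the eigenvalue x of the endomorphism that f induces on an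
   f-stable subspace V. *)
Definition eigen_mult (K : fieldType) (vT : vectType K) (f : 'End(vT))
  (V : {vspace vT}) (x : K) : nat := \dim (V :&: passmx.leigenspace f x)%VS.

Section Unitriangular.

Variable F : finFieldType.

Definition U11_set : {set {'GL_2[F]}} :=
  [set g : {'GL_2[F]} |
    [forall i : 'I_2, GLval g i i == 1] && (GLval g (1 : 'I_2) (0 : 'I_2) == 0)].

Definition U11op_set : {set {'GL_2[F]}} :=
  [set g : {'GL_2[F]} |
    [forall i : 'I_2, GLval g i i == 1] && (GLval g (0 : 'I_2) (1 : 'I_2) == 0)].

Fact U11_group_set : group_set U11_set.
Proof.
apply/group_setP; split=> [|g h]; rewrite !inE ?GL_1E.
  by rewrite !mxE eqxx andbT; apply/forallP => i; rewrite !mxE eqxx.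
case/andP=> /forallP g1 /eqP g10 /andP[/forallP h1 /eqP h10].
have [/eqP g00 /eqP g11] := (g1 0, g1 1).
have [/eqP h00 /eqP h11] := (h1 0, h1 1).
have e0 : lift ord0 ord0 = 1 :> 'I_2 by apply/val_inj.
rewrite GL_MxE; apply/andP; split; last first.
  by rewrite mxE !big_ord_recl big_ord0 e0 g10 h10 mul0r mulr0 !addr0.
apply/forallP => i; rewrite mxE !big_ord_recl big_ord0 e0 addr0.
have [->|->] : i = 0 \/ i = 1.
  by case: i => -[|[|//]] ?; [left | right]; apply/val_inj.
by rewrite g00 h00 h10 mulr0 mulr1 addr0.
by rewrite g11 h11 g10 mul0r mulr1 add0r.
Qed.

Fact U11op_group_set : group_set U11op_set.
Proof.
apply/group_setP; split=> [|g h]; rewrite !inE ?GL_1E.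
  by rewrite !mxE eqxx andbT; apply/forallP => i; rewrite !mxE eqxx.
case/andP=> /forallP g1 /eqP g01 /andP[/forallP h1 /eqP h01].
have [/eqP g00 /eqP g11] := (g1 0, g1 1).
have [/eqP h00 /eqP h11] := (h1 0, h1 1).
have e0 : lift ord0 ord0 = 1 :> 'I_2 by apply/val_inj.
rewrite GL_MxE; apply/andP; split; last first.
  by rewrite mxE !big_ord_recl big_ord0 e0 g01 h01 mul0r mulr0 !addr0.
apply/forallP => i; rewrite mxE !big_ord_recl big_ord0 e0 addr0.
have [->|->] : i = 0 \/ i = 1.
  by case: i => -[|[|//]] ?; [left | right]; apply/val_inj.
by rewrite g00 h00 g01 mul0r mulr1 addr0.
by rewrite g11 h11 h01 mulr0 mulr1 add0r.
Qed.

Canonical U11 : {group {'GL_2[F]}} := Group U11_group_set.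
Canonical U11op : {group {'GL_2[F]}} := Group U11op_group_set.

Definition radon_elt (K : fieldType) : group_algebra K {'GL_2[F]} :=
  (#|U11| ^ 2)%:R *:
    (subgroup_idem K U11 * subgroup_idem K U11op * subgroup_idem K U11).

Definition radon (K : fieldType) : 'End(group_algebra K {'GL_2[F]}) :=
  amulr (radon_elt K).

(* R = R e_U, so the operator acts on K[GL_2(F)/U]. *)
Fact radon_stable (K : fieldType) :
  (radon K @: coset_space K U11 <= coset_space K U11)%VS.
Proof.
apply/subvP => _ /memv_imgP[a _ ->]; rewrite lfunE /=.
apply/memv_imgP; exists ((#|U11| ^ 2)%:R *:
  (a * (subgroup_idem K U11 * subgroup_idem K U11op))); first exact: memvf.
by rewrite lfunE /= /radon_elt -scalerAr -[RHS]scalerAl !mulrA.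
Qed.

End Unitriangular.

(* Main.v *)
From HB Require Import structures.
Require Import Defs.
From mathcomp Require Import all_boot all_order all_algebra all_fingroup.
From mathcomp Require Import all_field.
From mathcomp Require Import reals complex.
From mathcomp Require Import ring zify.

(** Let U be the upper unitriangular group, U' the lower one, and let B consist
    of the upper triangular matrices of determinant 1, so that U <= B <= SL_2.
    Everything comes from one identity in the group algebra,

      q^2 e_U e_U' e_U = q^2 e_SL + 1 (e_B - e_SL) + q (e_U - e_B),

    proved as [radon_eltE].  It is the Bruhat decomposition of SL_2 in disguise:
    a product u v w with u, w in U and v in U' lies in U when v = 1, each
    element of U being reached q times, and when v runs over the other elements
    of U' the products u v w run exactly once over the big cell SL_2 \ B
    ([big_SL2_cell], [ga_sum_bruhat]).

    Because the three groups form a chain, e_SL, e_B - e_SL and e_U - e_B are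
    orthogonal idempotents with sum e_U.  Right multiplication by their
    combination with distinct coefficients therefore has those coefficients as
    eigenvalues on K[G] e_U, and its eigenspaces are the left ideals that the
    idempotents generate ([eigen_mult_tower]).  The dimensions are differences
    of dimensions of spaces K[G/H], and the latter are the indices |G : H|
    ([dim_coset_space]): q - 1, (q - 1)(q + 1) and (q - 1)^2 (q + 1) for
    H = SL_2, B and U.

    Geometrically, G/U is the set of pairs formed by a nonzero vector (the first
    column) and a determinant.  Once the determinant is fixed, e_SL projects
    onto the constant functions of the vector, and e_B onto the functions that
    are constant on punctured lines. *)

Set Implicit Arguments.
Unset Strict Implicit.
Unset Printing Implicit Defensive.

Import GRing.Theory.

Local Open Scope ring_scope.

(** * Right multiplication by a combination of orthogonal idempotents *)

Section Idempotents.

Variables (K : fieldType) (A : falgType K).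
Implicit Types (p r a s b u : A) (x y z : K).

Lemma mem_limg_amulr p a :
  p * p = p -> reflect (a * p = a) (a \in limg (amulr p)).
Proof.
move=> pp; apply: (iffP memv_imgP) => [[b _ ->]|ap].
  by rewrite lfunE /= -mulrA pp.
by exists a; rewrite ?memvf // lfunE /= ap.
Qed.

(** The left ideals of orthogonal idempotents are in direct sum: an element of
    both satisfies a = a p1 = a p2, hence a = a p1 p2 = 0. *)
Lemma dim_limg_amulrD p1 p2 :
    p1 * p1 = p1 -> p2 * p2 = p2 -> p1 * p2 = 0 -> p2 * p1 = 0 ->
  \dim (limg (amulr (p1 + p2))) =
    (\dim (limg (amulr p1)) + \dim (limg (amulr p2)))%N.
Proof.
move=> p11 p22 p12 p21; rewrite -dimv_disjoint_sum; last first.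
  apply/eqP; rewrite -subv0; apply/subvP => a; rewrite memv_cap memv0.
  by case/andP=> /(mem_limg_amulr _ p11) <- /(mem_limg_amulr _ p22) <-;
    rewrite -mulrA p12 mulr0.
have pp : (p1 + p2) * (p1 + p2) = p1 + p2.
  by rewrite mulrDl !mulrDr p11 p22 p12 p21 addr0 add0r.
congr (\dim _); apply/eqP; rewrite eqEsubv; apply/andP; split; apply/subvP => a.
  move/(mem_limg_amulr _ pp) <-; rewrite mulrDr.
  by apply: memv_add; apply/mem_limg_amulr; rewrite // -mulrA (p11, p22).
case/memv_addP=> b /(mem_limg_amulr _ p11) <- [c /(mem_limg_amulr _ p22) <- ->].
apply/(mem_limg_amulr _ pp); rewrite mulrDl !mulrDr -!mulrA.
by rewrite p11 p22 p12 p21 !mulr0 addr0 add0r.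
Qed.

(** If a is an eigenvector for x, multiplying a r = x a by p2 gives
    y a p2 = x a p2, so a p2 = 0, and a p3 = 0 in the same way; only the
    component of a along p1 survives. The hypotheses are symmetric in the three
    idempotents, so permuting them treats the other two eigenvalues. *)
Lemma eigen_mult_amulr x y z p1 p2 p3 :
    p1 * p1 = p1 -> p2 * p2 = p2 -> p3 * p3 = p3 ->
    p1 * p2 = 0 -> p2 * p1 = 0 -> p1 * p3 = 0 -> p3 * p1 = 0 ->
    p2 * p3 = 0 -> p3 * p2 = 0 -> x != y -> x != z ->
  eigen_mult (amulr (x *: p1 + y *: p2 + z *: p3))
    (limg (amulr (p1 + p2 + p3))) x = \dim (limg (amulr p1)).
Proof.
move=> p11 p22 p33 p12 p21 p13 p31 p23 p32 xy xz.
set r := (X in amulr X); set e := p1 + p2 + p3.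
have ee : e * e = e.
  rewrite /e !mulrDl !mulrDr p11 p22 p33 p12 p21 p13 p31 p23 p32.
  by rewrite !addr0 !add0r.
congr (\dim _); apply/vspaceP => a; rewrite memv_cap memv_ker.
rewrite add_lfunE opp_lfunE scale_lfunE id_lfunE lfunE /= subr_eq0.
apply/andP/(mem_limg_amulr _ p11) => [[/(mem_limg_amulr _ ee) ae /eqP ar]|ap].
  have a_killed w p' : r * p' = w *: p' -> x != w -> a * p' = 0.
    move=> rp xw; have /eqP : (x - w) *: (a * p') = 0.
      by rewrite scalerBl [w *: _]scalerAr -rp mulrA ar -scalerAl subrr.
    by rewrite scaler_eq0 subr_eq0 (negbTE xw) => /eqP.
  have rp2 : r * p2 = y *: p2.
    by rewrite /r !mulrDl -!scalerAl p12 p22 p32 !scaler0 add0r addr0.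
  have rp3 : r * p3 = z *: p3.
    by rewrite /r !mulrDl -!scalerAl p13 p23 p33 !scaler0 !add0r.
  rewrite -{2}ae /e !mulrDr.
  by rewrite (a_killed _ _ rp2) // (a_killed _ _ rp3) // !addr0.
split.
  apply/(mem_limg_amulr _ ee).
  by rewrite -ap -mulrA /e !mulrDr p11 p12 p13 !mulr0 !addr0.
have p1r : p1 * r = x *: p1.
  by rewrite /r !mulrDr -!scalerAr p11 p12 p13 !scaler0 !addr0.
by rewrite -ap -mulrA p1r scalerAr.
Qed.

(** A chain of idempotents s, b, u, each absorbing the later ones, splits u into
    the orthogonal idempotents s, b - s and u - b. The dimensions enter as
    ds, db and du because they are computed elsewhere by counting cosets. *)
Lemma eigen_mult_tower x y z s b u ds db du :
    s * s = s -> b * b = b -> u * u = u ->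
    s * b = s -> b * s = s -> s * u = s -> u * s = s -> b * u = b -> u * b = b ->
    x != y -> x != z -> y != z ->
    \dim (limg (amulr s)) = ds -> \dim (limg (amulr b)) = db ->
    \dim (limg (amulr u)) = du ->
  let mult := eigen_mult (amulr (x *: s + y *: (b - s) + z *: (u - b)))
                (limg (amulr u)) in
  [/\ mult x = ds, mult y = (db - ds)%N & mult z = (du - db)%N].
Proof.
move=> ss bb uu sb bs su us bu ub xy xz yz <- <- <- mult.
pose p := b - s; pose p' := u - b.
have pp : p * p = p by rewrite mulrBl !mulrBr ss bb sb bs subrr subr0.
have pp' : p' * p' = p' by rewrite mulrBl !mulrBr uu bb bu ub subrr subr0.
have sp : s * p = 0 by rewrite mulrBr ss sb subrr.
have ps : p * s = 0 by rewrite mulrBl ss bs subrr.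
have sp' : s * p' = 0 by rewrite mulrBr su sb subrr.
have ps' : p' * s = 0 by rewrite mulrBl us bs subrr.
have p_p' : p * p' = 0 by rewrite mulrBl !mulrBr bu bb su sb !subrr.
have p'p : p' * p = 0 by rewrite mulrBl !mulrBr ub us bb bs subrr.
have defb : b = s + p by rewrite addrC subrK.
have defu : u = s + p + p' by rewrite -defb addrC subrK.
have dimb : \dim (limg (amulr b)) =
    (\dim (limg (amulr s)) + \dim (limg (amulr p)))%N.
  by rewrite {1}defb dim_limg_amulrD.
have dimu : \dim (limg (amulr u)) =
    (\dim (limg (amulr b)) + \dim (limg (amulr p')))%N.
  rewrite -dim_limg_amulrD //; first by rewrite addrC subrK.
    by rewrite mulrBr bu bb subrr.
  by rewrite mulrBl ub bb subrr.
rewrite dimu dimb !addKn /mult -/p -/p' defu; split.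
- by apply: eigen_mult_amulr.
- rewrite [s + p]addrC [x *: s + _]addrC; apply: eigen_mult_amulr => //.
  by rewrite eq_sym.
- rewrite (addrC (s + p)) (addrC (x *: s + y *: p)) (addrA p') (addrA (z *: p')).
  by apply: eigen_mult_amulr => //; rewrite eq_sym.
Qed.

End Idempotents.

(** * Subgroup idempotents and coset spaces *)

Section SubgroupIdempotents.

Variables (K : fieldType) (gT : finGroupType).
Hypothesis charK : [pchar K] =i pred0.

Local Notation ga := (group_algebra K gT).
Local Notation e := (subgroup_idem K).

Definition ga_sum (S : {set gT}) : ga := \sum_(g in S) ga_basis K g.

Lemma ga_basisM g h : ga_basis K g * ga_basis K h = ga_basis K (g * h)%g :> ga.
Proof.
apply/ffunP => k; rewrite ga_mul_basis !ffunE; congr (_%:R).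
by rewrite (can2_eq (mulgKV h) (mulgK h)).
Qed.

Lemma natr_card_neq0 (H : {group gT}) : #|H|%:R != 0 :> K.
Proof. by rewrite ((pcharf0P K).1 charK) -lt0n cardG_gt0. Qed.

Lemma ga_sum_idem (H : {group gT}) : ga_sum H = #|H|%:R *: e H.
Proof. by rewrite scalerA mulfV ?scale1r // natr_card_neq0. Qed.

(** Translating the sum over L by an element h of H permutes its terms, so each
    of the |H| elements averaged by e_H fixes e_L. *)
Lemma idem_mull (H L : {group gT}) : H \subset L -> e H * e L = e L.
Proof.
move=> sHL; rewrite /subgroup_idem -scalerAr -scalerAl mulr_suml.
rewrite (eq_bigr (fun=> ga_sum L)) => [|h Hh].
  rewrite sumr_const -scaler_nat [X in _ *: X]scalerA.
  by rewrite mulVf ?scale1r ?natr_card_neq0.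
rewrite mulr_sumr /ga_sum [RHS](reindex_inj (mulgI h)) /=.
by apply: eq_big => [k|k _];
  [rewrite groupMl ?(subsetP sHL h) | rewrite ga_basisM].
Qed.

Lemma idem_mulr (H L : {group gT}) : H \subset L -> e L * e H = e L.
Proof.
move=> sHL; rewrite /subgroup_idem -scalerAr -scalerAl mulr_sumr.
rewrite scalerA mulrC -scalerA.
rewrite (eq_bigr (fun=> ga_sum L)) => [|h Hh].
  rewrite sumr_const -scaler_nat [X in _ *: X]scalerA.
  by rewrite mulVf ?scale1r ?natr_card_neq0.
rewrite mulr_suml /ga_sum [RHS](reindex_inj (mulIg h)) /=.
by apply: eq_big => [k|k _];
  [rewrite groupMr ?(subsetP sHL h) | rewrite ga_basisM].
Qed.

(** By [mem_coset_space], K[G/H] consists of the functions that are constant on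
    left cosets; pulling back along g |-> g H identifies it with the space of
    all functions on the set of cosets. *)
Lemma dim_coset_space (H : {group gT}) :
  \dim (coset_space K H) = #|[set: gT] : H|%g.
Proof.
pose I := {C : {set gT} | C \in lcosets H [set: gT]}.
have lcI g : (g *: H)%g \in lcosets H [set: gT].
  by apply/lcosetsP; exists g; rewrite ?inE.
pose cos g : I := Sub (g *: H)%g (lcI g).
pose Phi (f : {ffun I -> K^o}) : ga := [ffun g => f (cos g)].
have PhiL : linear Phi by move=> a u v; apply/ffunP => g; rewrite !ffunE.
pose PhiLin := GRing.isLinear.Build _ _ _ _ Phi PhiL.
pose Phi' : {linear {ffun I -> K^o} -> ga} := HB.pack Phi PhiLin.
have -> : coset_space K H = limg (linfun Phi').
  apply/vspaceP => a; apply/(mem_coset_space _ (natr_card_neq0 H))/memv_imgP.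
    move=> aH; exists [ffun C : I => a (repr (val C))]; rewrite ?memvf //.
    apply/ffunP => g; rewrite lfunE /= !ffunE /=.
    have /lcosetP[h Hh ->] : repr (g *: H)%g \in (g *: H)%g.
      by apply: mem_repr (lcoset_refl H g).
    by rewrite aH.
  case=> f _ -> h Hh g; rewrite lfunE /= !ffunE; congr (f _).
  by apply: val_inj; rewrite /= lcosetM lcoset_id.
rewrite limg_dim_eq; last first.
  apply/eqP; rewrite capfv -subv0; apply/subvP => f.
  rewrite memv_ker lfunE memv0.
  move/eqP => /ffunP f0; apply/eqP/ffunP => -[C HC].
  have /lcosetsP[g _ eC] := HC; have := f0 g; rewrite !ffunE => <-.
  by congr (f _); apply: val_inj.
rewrite dimvf /dim /= muln1 card_sig -card_lcosets.
by apply: eq_card => C; rewrite !inE.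
Qed.

End SubgroupIdempotents.

(** * Two by two matrices, and the subgroups B and SL_2 *)

Section GL2.

Variable F : finFieldType.
Local Notation G := {'GL_2[F]}.
Local Notation q := #|F|.

Definition mx2 (a b c d : F) : 'M[F]_2 :=
  \matrix_(i, j) if i == 0 then if j == 0 then a else b
                 else if j == 0 then c else d.

Lemma mx2E a b c d : (mx2 a b c d 0 0 = a) * (mx2 a b c d 0 1 = b) *
  (mx2 a b c d 1 0 = c) * (mx2 a b c d 1 1 = d).
Proof. by rewrite !mxE. Qed.

Lemma ord2P (P : 'I_2 -> Prop) : P 0 -> P 1 -> forall i, P i.
Proof.
move=> P0 P1 [[|[|//]] lti].
  by rewrite (_ : Ordinal lti = 0) //; apply: val_inj.
by rewrite (_ : Ordinal lti = 1) //; apply: val_inj.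
Qed.

Lemma mx2_eta (M : 'M[F]_2) : M = mx2 (M 0 0) (M 0 1) (M 1 0) (M 1 1).
Proof. by apply/matrixP; apply: ord2P; apply: ord2P; rewrite !mxE. Qed.

Lemma det_mx2 a b c d : \det (mx2 a b c d) = a * d - b * c.
Proof.
rewrite (expand_det_row _ 0) !big_ord_recl big_ord0 addr0 /cofactor !det_mx11.
rewrite !mxE /= expr0 expr1 mul1r mulN1r; congr (_ + _).
by rewrite mulrN.
Qed.

Lemma mul_mx2 a b c d a' b' c' d' :
  mx2 a b c d *m mx2 a' b' c' d' =
  mx2 (a * a' + b * c') (a * b' + b * d') (c * a' + d * c') (c * b' + d * d').
Proof.
by apply/matrixP; apply: ord2P; apply: ord2P;
  rewrite !mxE !big_ord_recl big_ord0 !mxE addr0.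
Qed.

(** Junk value: the identity when the determinant a d - b c vanishes. *)
Definition gl2 a b c d : G := insubd (1%g : G) (mx2 a b c d).

Lemma gl2K a b c d : a * d - b * c != 0 -> GLval (gl2 a b c d) = mx2 a b c d.
Proof. by move=> dt; apply: insubdK; rewrite unitmxE det_mx2 unitfE. Qed.

Lemma gl2_eta (g : G) :
  g = gl2 (GLval g 0 0) (GLval g 0 1) (GLval g 1 0) (GLval g 1 1).
Proof.
apply: val_inj; rewrite /= gl2K -?det_mx2 -mx2_eta // -unitfE -unitmxE.
exact: (GL_unit g).
Qed.

Lemma gl2_eqP a b c d (g : G) : a * d - b * c != 0 ->
  reflect
    [/\ GLval g 0 0 = a, GLval g 0 1 = b, GLval g 1 0 = c & GLval g 1 1 = d]
    (gl2 a b c d == g).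
Proof.
move=> dt; apply: (iffP eqP) => [<-|[<- <- <- <-]]; last by rewrite -gl2_eta.
by rewrite gl2K // !mx2E.
Qed.

Lemma gl2M a b c d a' b' c' d' : a * d - b * c != 0 -> a' * d' - b' * c' != 0 ->
  (gl2 a b c d * gl2 a' b' c' d')%g =
  gl2 (a * a' + b * c') (a * b' + b * d') (c * a' + d * c') (c * b' + d * d').
Proof.
move=> dt dt'; apply: val_inj; rewrite -[LHS]/(GLval _) -[RHS]/(GLval _) gl2K.
  by rewrite GL_MxE !gl2K // mul_mx2.
by rewrite (_ : _ - _ = (a * d - b * c) * (a' * d' - b' * c')) ?mulf_neq0 //; ring.
Qed.

Definition SL2_set : {set G} := [set g | \det (GLval g) == 1].

(** The Borel subgroup of SL_2. *)
Definition SB2_set : {set G} := [set g in SL2_set | GLval g 1 0 == 0].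

Fact SL2_group_set : group_set SL2_set.
Proof.
apply/group_setP; split=> [|g h]; rewrite !inE ?GL_1E ?det1 //.
by rewrite GL_MxE det_mulmx => /eqP -> /eqP ->; rewrite mulr1.
Qed.
Canonical SL2 : {group G} := Group SL2_group_set.

Fact SB2_group_set : group_set SB2_set.
Proof.
apply/group_setP; split=> [|g h]; first by rewrite !inE ?GL_1E ?det1 ?mxE ?eqxx.
rewrite !inE GL_MxE det_mulmx => /andP[/eqP -> /eqP g10] /andP[/eqP -> /eqP h10].
rewrite mulr1 eqxx (mx2_eta (GLval g)) (mx2_eta (GLval h)) mul_mx2 mx2E g10 h10.
by rewrite mul0r mulr0 addr0 /=.
Qed.
Canonical SB2 : {group G} := Group SB2_group_set.

Lemma sub_SB2_SL2 : SB2 \subset SL2.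
Proof. by apply/subsetP => g; rewrite inE => /andP[]. Qed.

Lemma mem_U11 g : (g \in U11 F) =
  [&& GLval g 0 0 == 1, GLval g 1 0 == 0 & GLval g 1 1 == 1].
Proof.
rewrite inE; apply/andP/and3P => [[/forallP g1 ->]|[g0 -> g1]]; first by rewrite !g1.
by split=> //; apply/forallP; apply: ord2P.
Qed.

Lemma mem_U11op g : (g \in U11op F) =
  [&& GLval g 0 0 == 1, GLval g 0 1 == 0 & GLval g 1 1 == 1].
Proof.
rewrite inE; apply/andP/and3P => [[/forallP g1 ->]|[g0 -> g1]]; first by rewrite !g1.
by split=> //; apply/forallP; apply: ord2P.
Qed.

Lemma det_eta (g : G) :
  \det (GLval g) = GLval g 0 0 * GLval g 1 1 - GLval g 0 1 * GLval g 1 0.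
Proof. by rewrite {1}(mx2_eta (GLval g)) det_mx2. Qed.

Lemma sub_U11_SB2 : U11 F \subset SB2.
Proof.
apply/subsetP => g; rewrite mem_U11 !inE det_eta => /and3P[/eqP -> /eqP -> /eqP ->].
by rewrite mulr0 mulr1 subr0 !eqxx.
Qed.

Definition upper (x : F) : G := gl2 1 x 0 1.
Definition lower (y : F) : G := gl2 1 0 y 1.

Lemma lower0 : lower 0 = 1%g.
Proof.
apply: val_inj; rewrite -[LHS]/(GLval _) gl2K ?mulr1 ?mul0r ?subr0 ?oner_eq0 //.
by apply/matrixP; apply: ord2P; apply: ord2P; rewrite !mxE.
Qed.

(** Parametrizations are stated as changes of variables in sums with values in
    any commutative monoid, so that they serve both to count a subgroup and to
    compute its sum in the group algebra. *)
Section Sums.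

Variables (V : nmodType) (f : G -> V).

Lemma big_U11 : \sum_(g in U11 F) f g = \sum_x f (upper x).
Proof.
rewrite (reindex_onto upper (fun g => GLval g 0 1)) => [|g].
  apply: eq_bigl => x; rewrite mem_U11 /upper gl2K ?mx2E ?eqxx //.
  by rewrite mulr1 mulr0 subr0 oner_eq0.
rewrite mem_U11 => /and3P[/eqP g0 /eqP g10 /eqP g1].
by apply/eqP/gl2_eqP; rewrite ?mulr1 ?mulr0 ?subr0 ?oner_eq0.
Qed.

Lemma big_U11op : \sum_(g in U11op F) f g = \sum_y f (lower y).
Proof.
rewrite (reindex_onto lower (fun g => GLval g 1 0)) => [|g].
  apply: eq_bigl => x; rewrite mem_U11op /lower gl2K ?mx2E ?eqxx //.
  by rewrite mulr1 mul0r subr0 oner_eq0.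
rewrite mem_U11op => /and3P[/eqP g0 /eqP g10 /eqP g1].
by apply/eqP/gl2_eqP; rewrite ?mulr1 ?mul0r ?subr0 ?oner_eq0.
Qed.

Lemma big_SB2 : \sum_(g in SB2) f g =
  \sum_(t : F * F | t.1 != 0) f (gl2 t.1 t.2 0 t.1^-1).
Proof.
rewrite (reindex_onto (fun t : F * F => gl2 t.1 t.2 0 t.1^-1)
  (fun g => (GLval g 0 0, GLval g 0 1))) => [|g].
  apply: eq_bigl => -[a b] /=; have [->|a0] := eqVneq a 0.
    (* For a = 0 the matrix is the junk value; reading off its entries cannot
       give back a zero diagonal entry, since the determinant is 1. *)
    apply/negbTE; apply/negP => /andP[].
    rewrite !inE det_eta => /andP[/eqP d1 /eqP g10] /eqP[g00 _].
    by move/eqP: d1; rewrite g00 g10 mul0r mulr0 subr0 eq_sym oner_eq0.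
  have dt : a * a^-1 - b * 0 = 1 by rewrite mulr0 subr0 mulfV.
  by rewrite !inE gl2K ?dt ?oner_eq0 // det_mx2 dt !mx2E !eqxx.
rewrite !inE det_eta => /andP[/eqP d1 /eqP g10].
move: d1; rewrite g10 mulr0 subr0 => d1.
have g00 : GLval g 0 0 != 0.
  by apply/eqP => g00; move/eqP: d1; rewrite g00 mul0r eq_sym oner_eq0.
apply/eqP/gl2_eqP => /=; rewrite ?mulr0 ?subr0 ?mulfV ?oner_eq0 //; split=> //.
by rewrite -[LHS](mulKf g00) d1 mulr1.
Qed.

(** The big Bruhat cell. With (x, y, z) the coordinates, the product has lower
    left entry y and diagonal entries 1 + x y and 1 + y z; as y is nonzero these
    determine x and z, and the determinant then forces the remaining entry. *)
Lemma big_SL2_cell : \sum_(g in SL2 :\: SB2) f g =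
  \sum_(t : F * F * F | t.1.2 != 0) f (upper t.1.1 * lower t.1.2 * upper t.2)%g.
Proof.
have cellE x y z : (upper x * lower y * upper z)%g =
    gl2 (1 + x * y) ((1 + x * y) * z + x) y (1 + y * z).
  rewrite /upper /lower !gl2M; first (by congr gl2; ring);
    by rewrite (_ : _ - _ = 1) ?oner_eq0 //; ring.
have dtE (x y z : F) :
    (1 + x * y) * (1 + y * z) - ((1 + x * y) * z + x) * y = 1 by ring.
rewrite (reindex_onto
  (fun t : F * F * F => (upper t.1.1 * lower t.1.2 * upper t.2)%g)
  (fun g => ((GLval g 0 0 - 1) / GLval g 1 0, GLval g 1 0,
             (GLval g 1 1 - 1) / GLval g 1 0))) => [|g].
  apply: eq_bigl => -[[x y] z].
  rewrite cellE !inE gl2K ?dtE ?oner_eq0 // det_mx2 dtE !mx2E eqxx andbT /=.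
  have [//|y0] := eqVneq y 0.
  by rewrite !(addrC 1) !addrK mulfK // mulrAC mulfV // mul1r eqxx.
rewrite !inE negb_and det_eta => /andP[]; case: eqP => //= d1 g10 _.
rewrite cellE; apply/eqP/gl2_eqP; rewrite ?dtE ?oner_eq0 //.
have e0 : GLval g 0 0 = 1 + (GLval g 0 0 - 1) / GLval g 1 0 * GLval g 1 0.
  by rewrite divfK // addrC subrK.
split=> //; last by rewrite mulrCA mulfV // mulr1 addrC subrK.
rewrite -e0; apply: (mulIf g10).
rewrite mulrDl divfK // -mulrA divfK //.
have -> : GLval g 0 1 * GLval g 1 0 = GLval g 0 0 * GLval g 1 1 - 1.
  by rewrite -d1; ring.
ring.
Qed.

End Sums.

Lemma card_U11 : #|U11 F| = q.
Proof. by rewrite -sum1_card big_U11 sum1_card. Qed.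

Lemma card_U11op : #|U11op F| = q.
Proof. by rewrite -sum1_card big_U11op sum1_card. Qed.

Lemma card_SB2 : #|SB2| = (q.-1 * q)%N.
Proof.
rewrite -sum1_card big_SB2 sum1_card -(cardC1 (0 : F)) -cardX.
by apply: eq_card => -[a b]; rewrite !inE andbT.
Qed.

Lemma card_SL2 : #|SL2| = (q * q.-1 * q.+1)%N.
Proof.
rewrite -(cardsID SB2) (setIidPr sub_SB2_SL2) card_SB2 -sum1_card big_SL2_cell.
rewrite sum1_card (_ : #|_| = (q * q.-1 * q)%N); first by lia.
rewrite -(cardC1 (0 : F)) -!cardX.
by apply: eq_card => -[[x y] z]; rewrite !inE andbT.
Qed.

End GL2.

(** * The Radon element in terms of subgroup idempotents *)

Section RadonElement.

Variables (K : fieldType) (F : finFieldType).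
Hypothesis charK : [pchar K] =i pred0.
Local Notation q := #|F|.
Local Notation e := (subgroup_idem K).
Local Notation "1[ H ]" := (ga_sum K H) (at level 0).

(** Split the sum over the lower unitriangular group: its identity term
    contributes the square of the sum over U, and each of its other terms lands
    in the big cell. *)
Lemma ga_sum_bruhat :
  1[U11 F] * 1[U11op F] * 1[U11 F] = q%:R *: 1[U11 F] + (1[SL2 F] - 1[SB2 F]).
Proof.
have -> : 1[U11op F] =
    ga_basis K 1%g + \sum_(y : F | y != 0) ga_basis K (lower y).
  by rewrite /ga_sum big_U11op [LHS](bigD1 (0 : F) isT) lower0.
rewrite mulrDr mulrDl mulr1; congr (_ + _).
  by rewrite ga_sum_idem // -scalerAl -scalerAr idem_mull // card_U11.
have -> : 1[SL2 F] - 1[SB2 F] = 1[SL2 F :\: SB2 F].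
  rewrite /ga_sum [X in X - _](big_setID (SB2 F)) /= (setIidPr (sub_SB2_SL2 F)).
  by rewrite addrAC subrr add0r.
rewrite /ga_sum big_SL2_cell big_U11 mulr_suml.
rewrite (eq_bigr (fun x =>
    \sum_(y : F | y != 0) ga_basis K (upper x * lower y)%g)).
  rewrite pair_big mulr_suml /=.
  rewrite (eq_bigr (fun t : F * F =>
      \sum_z ga_basis K (upper t.1 * lower t.2 * upper z)%g)).
    by rewrite pair_big /=; apply: eq_bigl => t; rewrite andbT.
  by move=> t _; rewrite mulr_sumr; apply: eq_bigr => z _; rewrite ga_basisM.
by move=> x _; rewrite mulr_sumr; apply: eq_bigr => y _; rewrite ga_basisM.
Qed.

(** Each sum in [ga_sum_bruhat] is the order of the group times its idempotent,
    the orders being q for U and U', q (q - 1) for B, q (q^2 - 1) for SL_2. *)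
Lemma radon_eltE : radon_elt F K =
  (q ^ 2)%:R *: e (SL2 F) + 1 *: (e (SB2 F) - e (SL2 F)) +
  q%:R *: (e (U11 F) - e (SB2 F)).
Proof.
have q0 : q%:R != 0 :> K by rewrite -(card_U11 F) natr_card_neq0.
have q1 : q.-1%:R = q%:R - 1 :> K.
  by rewrite -[in RHS](prednK (ltnW (finRing_gt1 F))) -natr1 addrK.
(* With the denominators of the three idempotents cleared, the left-hand side
   of the identity of sums is q times the Radon element. *)
apply: (scalerI q0); rewrite /radon_elt.
have := ga_sum_bruhat; rewrite !ga_sum_idem // card_U11 card_U11op card_SB2 card_SL2.
move: (e (U11 F)) (e (U11op F)) (e (SB2 F)) (e (SL2 F)) => u v b s.
rewrite -!(scalerAl, scalerAr) !scalerA !natrM q1 -natr1 scale1r mulrA => ->.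
move: (q%:R : K) => x.
have -> : x * (x - 1) * (x + 1) = x * (x * x) - x by ring.
have -> : (x - 1) * x = x * x - x by ring.
rewrite !scalerDr !scalerN !scalerBl !scalerA opprB.
by rewrite [RHS](AC ((1 * 2) * 2) (4 * ((1 * 3) * (2 * 5)))).
Qed.

End RadonElement.

(** * Multiplicities of the eigenvalues *)

Theorem proposition4p2 (R : realType) (F : finFieldType) :
  let q := #|F| in
  let mult := eigen_mult (radon F R[i]) (coset_space R[i] (U11 F)) in
  [/\ mult (q ^ 2)%:R = (q - 1)%N,
      mult q%:R = ((q - 1) * (q ^ 2 - q - 2))%N
    & mult 1 = ((q - 1) * q)%N].
Proof.
move=> q mult; have charK : [pchar R[i]] =i pred0.
  by apply: Num.Theory.pchar_num.
have q_gt1 : (1 < q)%N by apply: finRing_gt1.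
have q_gt0 := ltnW q_gt1; have p_gt0 : (0 < q.-1)%N by lia.
have sUS := subset_trans (sub_U11_SB2 F) (sub_SB2_SL2 F).
have q2q : (q ^ 2)%:R != q%:R :> R[i].
  by rewrite Num.Theory.eqr_nat; apply/eqP; nia.
have q21 : (q ^ 2)%:R != 1 :> R[i].
  by rewrite Num.Theory.pnatr_eq1; apply/eqP; nia.
have q1 : 1 != q%:R :> R[i].
  by rewrite eq_sym Num.Theory.pnatr_eq1; apply/eqP; lia.
have dimE (H : {group {'GL_2[F]}}) n : (q * q.-1 ^ 2 * q.+1 = n * #|H|)%N ->
    \dim (limg (amulr (subgroup_idem R[i] H))) = n.
  rewrite -card_GL_2 => cardG; apply: etrans (dim_coset_space charK H) _.
  by rewrite -divgS ?subsetT // cardG mulnK.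
have dimS : \dim (limg (amulr (subgroup_idem R[i] (SL2 F)))) = q.-1.
  by apply: dimE; rewrite card_SL2 -/q; lia.
have dimB : \dim (limg (amulr (subgroup_idem R[i] (SB2 F)))) =
    (q.-1 * q.+1)%N.
  by apply: dimE; rewrite card_SB2 -/q; lia.
have dimU : \dim (limg (amulr (subgroup_idem R[i] (U11 F)))) =
    (q.-1 ^ 2 * q.+1)%N.
  by apply: dimE; rewrite card_U11 -/q; lia.
have [m_q2 m_1 m_q] := eigen_mult_tower
  (idem_mull charK (subxx (SL2 F))) (idem_mull charK (subxx (SB2 F)))
  (idem_mull charK (subxx (U11 F)))
  (idem_mulr charK (sub_SB2_SL2 F)) (idem_mull charK (sub_SB2_SL2 F))
  (idem_mulr charK sUS) (idem_mull charK sUS)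
  (idem_mulr charK (sub_U11_SB2 F)) (idem_mull charK (sub_U11_SB2 F))
  q21 q2q q1 dimS dimB dimU.
rewrite /mult /radon radon_eltE //; split.
- by rewrite subn1; exact: m_q2.
- by apply: etrans m_q _; nia.
- by apply: etrans m_1 _; nia.
Qed.
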